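(* For integers $m\ge0$ define \begin{align*} B_{\phi,m} & = m+1 - \frac{1}{8}\Bigl(8 - 5 (-1)^{u_1} - 4 \left(-2 + (-1)^{u_1} + (-1)^{u_2}\right) m + 2 (-1)^{u_1} u_1 (3u_1+2) + (-1)^{u_2} (6u_2^2+8u_2-3)\Bigr), \\ B_{\mu, m} & = [m = 0] + \sum_{b = \pm 1} \sum_{k=1}^{\lfloor (\sqrt{24m+25}-b)/6 \rfloor} (-1)^k \left[m+1-\tfrac{k(3k+b)}{2} = 1\right], \\ B_{\lambda, m} & = \left[\sqrt{m+1} \in \mathbb{Z}\right] - \sum_{b = \pm 1} \sum_{k=1}^{\lfloor (\sqrt{24m+1}-b)/6 \rfloor} (-1)^{k+1} \left[\sqrt{m+1-\tfrac{k(3k+b)}{2}} \in \mathbb{Z}\right], \\ B_{\Lambda, m} & = \log(m+1) - \sum_{b = \pm 1} \sum_{k=1}^{\lfloor (\sqrt{24m+1}-b)/6 \rfloor} (-1)^{k+1} \log\left(m+1-\tfrac{k(3k+b)}{2}\right), \\ B_{|\mu|, m} & = 2^{\omega(m+1)} - \sum_{b = \pm 1} \sum_{k=1}^{\lfloor (\sqrt{24m+1}-b)/6 \rfloor} (-1)^{k+1} 2^{\omega(m+1-k(3k+b)/2)}, \\ B_{J_t, m} & = (m+1)^t - \sum_{b = \pm 1} \sum_{k=1}^{\lfloor (\sqrt{24m+1}-b)/6 \rfloor} (-1)^{k+1} \left(m+1-\tfrac{k(3k+b)}{2}\right)^t, \end{align*} where $u_1 = u_1(m) := \lfloor (\sqrt{24m+1}+1)/6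 \rfloor$, $u_2 = u_2(m) := \lfloor (\sqrt{24m+1}-1)/6 \rfloor$, and $t\in\mathbb{C}$ is fixed. Then for all integers $n\ge1$: \begin{align*} \phi(n) & = \sum_{m=0}^{n-1} \sum_{d\mid n} p(d-m-1)\, \mu(n / d)\, B_{\phi,m}, \\ \mu(n) & = \sum_{m=0}^{n-1} \sum_{d\mid n} p(d-m-1)\, \mu(n / d)\, B_{\mu,m}, \\ \lambda(n) & = \sum_{m=0}^{n-1} \sum_{d\mid n} p(d-m-1)\, \mu(n / d)\, B_{\lambda,m}, \\ \Lambda(n) & = \sum_{m=0}^{n-1} \sum_{d\mid n} p(d-m-1)\, \mu(n / d)\, B_{\Lambda,m}, \\ |\mu(n)| & = \sum_{m=0}^{n-1} \sum_{d\mid n} p(d-m-1)\, \mu(n / d)\, B_{|\mu|,m}, \\ J_t(n) & = \sum_{m=0}^{n-1} \sum_{d\mid n} p(d-m-1)\, \mu(n / d)\, B_{J_t,m}. \end{align*} Correspondingly, for each of these functions $a\in\{\phi,\mu,\lambda,\Lambda,|\mu|,J_t\}$ and every $x\ge1$, the summatory function $\Sigma_{a,x}:=\sum_{n\le x}a(n)$ is given by summing the right-hand side over all positive integers $n\le x$: $$\Sigma_{a,x}=\sum_{n\le x}\sum_{m=0}^{n-1} \sum_{d\mid n} p(d-m-1)\, \mu(n / d)\, B_{a,m}.$$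
   Context: $[P]$ denotes Iverson's bracket: $1$ if the condition $P$ is true, $0$ otherwise. Sums over $d\mid n$ run over positive divisors of $n$; sums over $b=\pm1$ run over the two values $b=1$ and $b=-1$; sums with upper limit smaller than the lower limit are empty. $p(n)$ is Euler's partition function (number of partitions of $n$, $p(0)=1$), with $p(n)=0$ for $n<0$. $\mu$ is the Möbius function, $\phi$ Euler's totient function, $\lambda$ Liouville's function, $\Lambda$ von Mangoldt's function, $\omega(n)$ the number of distinct primes dividing $n$, and $J_t$ Jordan's totient function for fixed $t\in\mathbb{C}$, characterized by $\sum_{d\mid n}J_t(d)=n^t$ for all $n\ge1$. *)

(* Defs.v *)
From HB Require Import structures.
From mathcomp Require Import all_boot all_order all_algebra.
From mathcomp Require Import reals sequences exp trigo.
From mathcomp Require Import complex.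

Set Implicit Arguments.
Unset Strict Implicit.
Unset Printing Implicit Defensive.

Import Order.TTheory GRing.Theory Num.Theory.
Local Open Scope ring_scope.
Local Open Scope complex_scope.

(* A partition of n is given by the multiplicities f i of the parts i.+1. *)
Definition npartitions (n : nat) : nat :=
  #|[set f : {ffun 'I_n -> 'I_n.+1} | (\sum_(i < n) i.+1 * f i == n)%N]|.

Definition npartitionsz (z : int) : nat :=
  if z is Posz n then npartitions n else 0%N.

(* The values at 0 of the arithmetic functions below are irrelevant. *)
Definition moebius (n : nat) : int :=
  if has (fun p => p ^ 2 %| n)%N (primes n) then 0 else (-1) ^+ size (primes n).

Definition liouville (n : nat) : int :=
  (-1) ^+ (\sum_(p <- primes n) logn p n)%N.

Definition omega (n : nat) : nat := size (primes n).

(* The bounds p <= n and k <= n are implied by n = p ^ k, p prime, k > 0. *)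
Definition mangoldt (R : realType) (n : nat) : R :=
  if [pick p : 'I_n.+1 |
        prime p && [exists k : 'I_n.+1, (0 < k)%N && (n == p ^ k)%N]] is Some p
  then ln (p%:R) else 0.

(* x ^ t = exp (t * ln x), for x > 0 real and t complex. *)
Definition cpow (R : realType) (x : R) (t : R[i]) : R[i] :=
  (expR (complex.Re t * ln x) * cos (complex.Im t * ln x))
  +i* (expR (complex.Re t * ln x) * sin (complex.Im t * ln x)).

Definition is_jordan_totient (R : realType) (t : R[i]) (J : nat -> R[i]) :=
  forall n : nat, (0 < n)%N -> \sum_(d <- divisors n) J d = cpow n%:R t.

Lemma jordan_totient_exists (R : realType) (t : R[i]) :
  exists J : nat -> R[i], is_jordan_totient t J.
Proof.
suff [J HJ] : exists J : nat -> R[i], forall n,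
    J n = cpow n%:R t - \sum_(d <- divisors n | (d < n)%N) J d.
  exists J => n n0.
  rewrite (bigD1_seq n) ?divisors_uniq //=; last by rewrite -dvdn_divisors.
  rewrite {1}HJ -[RHS](subrK (\sum_(d <- divisors n | (d < n)%N) J d)).
  congr (_ + _); rewrite big_seq_cond [RHS]big_seq_cond; apply: eq_bigl => d.
  rewrite -dvdn_divisors //; case: (boolP (d %| n)%N) => //= /(dvdn_leq n0) dn.
  by rewrite ltn_neqAle dn andbT.
pose F := fix F k (n : nat) : R[i] := if k is k'.+1 then
    cpow n%:R t - \sum_(d <- divisors n | (d < n)%N) F k' d else 0.
exists (fun n => F n.+1 n).
suff H k : forall l n, (n < k)%N -> (n < l)%N -> F k n = F l n.
  move=> n; rewrite [LHS]/=; congr (_ - _); apply: eq_bigr => d dn.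
  exact: H.
elim: k => [//|k IH] [//|l] n nk nl /=; congr (_ - _).
apply: eq_bigr => d dn; apply: IH; exact: leq_trans dn _.
Qed.

(* floor ((sqrt c - b) / 6); it is only used where (sqrt c - b) / 6 >= 0. *)
Definition pent_bound (R : realType) (c : nat) (b : int) : nat :=
  Num.truncn ((Num.sqrt (c%:R : R) - b%:~R) / 6).

(* m + 1 - k (3 k + b) / 2; the division is exact for b odd. *)
Definition pent_arg (m k : nat) (b : int) : int :=
  m.+1%:Z - ((k%:Z * (3 * k%:Z + b)) %/ 2)%Z.

Definition B_phi (R : realType) (m : nat) : R :=
  let u1 := pent_bound R (24 * m + 1) (-1) in
  let u2 := pent_bound R (24 * m + 1) 1 in
  let s1 : R := (-1) ^+ u1 in
  let s2 : R := (-1) ^+ u2 in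
  m%:R + 1 - 1 / 8 *
    (8 - 5 * s1 - 4 * (- 2 + s1 + s2) * m%:R
     + 2 * s1 * u1%:R * (3 * u1%:R + 2)
     + s2 * (6 * u2%:R ^+ 2 + 8 * u2%:R - 3)).

Definition B_mu (R : realType) (m : nat) : R :=
  (m == 0%N)%:R +
  \sum_(b <- [:: 1; -1] : seq int)
    \sum_(1 <= k < (pent_bound R (24 * m + 25) b).+1)
      (-1) ^+ k * (pent_arg m k b == 1)%:R.

Definition B_of (R : realType) (K : pzRingType) (s : int -> K) (m : nat) : K :=
  s m.+1%:Z -
  \sum_(b <- [:: 1; -1] : seq int)
    \sum_(1 <= k < (pent_bound R (24 * m + 1) b).+1)
      (-1) ^+ k.+1 * s (pent_arg m k b).

Definition B_lambda (R : realType) : nat -> R :=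
  B_of R (fun j => (Num.sqrt (j%:~R : R) \is a Num.int)%:R).

Definition B_Lambda (R : realType) : nat -> R :=
  B_of R (fun j => ln (j%:~R : R)).

(* The integers j passed to s by B_of are positive. *)
Definition B_absmu (R : realType) : nat -> R :=
  B_of R (fun j => 2 ^+ omega `|j|%N).

Definition B_J (R : realType) (t : R[i]) : nat -> R[i] :=
  B_of R (fun j => cpow (j%:~R : R) t).

Definition pd_sum (K : pzRingType) (B : nat -> K) (n : nat) : K :=
  \sum_(0 <= m < n) \sum_(d <- divisors n)
    (npartitionsz (d%:Z - m%:Z - 1))%:R * (moebius (n %/ d))%:~R * B m.

Definition summatory (R : realType) (K : pzRingType) (a : nat -> K) (x : R) : K :=
  \sum_(1 <= n < (Num.truncn x).+1) a n.

(* Main.v *)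
Require Import Defs.
From mathcomp Require Import all_boot all_order all_algebra.
From mathcomp Require Import reals complex.
From mathcomp Require Import exp cyclic zify ring lra.

Import Order.TTheory GRing.Theory Num.Theory.
Local Open Scope ring_scope.

(** Let s be the divisor sum of an arithmetic function a, that is, let s n be
    the sum of a d over the divisors d of n. The bounds in the definition of
    B_of select exactly the generalized pentagonal numbers k (3 k + b) / 2 that
    are at most m, so B_of s is the Cauchy product of the sequence s with
    Euler's pentagonal series, the sum of (-1) ^ k q ^ (k (3 k + b) / 2) over
    k and b (B_of_coef). By the pentagonal number theorem this series is the
    product of the factors 1 - q ^ i, whose inverse is the generating function
    of the partition numbers (npartitions_inverse). Hence convolving B_of s with
    the partition numbers gives s back (sum_npartitions_B_of), and Moebius
    inversion turns s into a (moebius_inversion): this is pd_sum_inverse.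

    The pentagonal number theorem is used only modulo a power of q, and is
    obtained from the identity of Shanks (shanks), which is an equality of
    polynomials proved by induction.

    It remains to identify s for the six functions. The divisor sums of the
    Moebius function, its absolute value, the Liouville function and the von
    Mangoldt function are the indicator of 1, 2 ^ omega, the indicator of the
    squares and the logarithm; all four are computed by splitting off one
    prime power from n (prime_power_ind and sum_divisors_pM). The divisor sum
    of the totient function is the identity, and that of J is its defining
    property. The sequences B_mu and B_phi, given by variants of the general
    formula, are reduced to it by B_muE and B_phiE. *)

(** * Polynomials modulo a power of the variable *)

(** Congruence modulo 'X^N, stated on coefficients: every identity between
    power series that is needed only concerns finitely many coefficients. *)
Definition eqmodX {K : nzRingType} (N : nat) (p q : {poly K}) :=
  forall i, (i < N)%N -> p`_i = q`_i.

Lemma eqmodXM {K : nzRingType} {N} {p p' q q' : {poly K}} :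
  eqmodX N p p' -> eqmodX N q q' -> eqmodX N (p * q) (p' * q').
Proof.
move=> pp qq i iN; rewrite !coefM; apply: eq_bigr => j _.
rewrite pp ?qq //; first by rewrite (leq_ltn_trans (leq_subr _ _)).
by apply: leq_trans iN; rewrite ltnS -ltnS ltn_ord.
Qed.

Lemma eqmodX_sym {K : nzRingType} {N} {p q : {poly K}} :
  eqmodX N p q -> eqmodX N q p.
Proof. by move=> pq i /pq. Qed.

Lemma eqmodX_trans {K : nzRingType} {N} {q p r : {poly K}} :
  eqmodX N p q -> eqmodX N q r -> eqmodX N p r.
Proof. by move=> pq qr i iN; rewrite pq ?qr. Qed.

Lemma eqmodXW {K : nzRingType} {M N} {p q : {poly K}} :
  (M <= N)%N -> eqmodX N p q -> eqmodX M p q.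
Proof. by move=> MN pq i iM; rewrite pq // (leq_trans iM). Qed.

Lemma eqmodX_addXn (K : nzRingType) N k (p q : {poly K}) :
  (N <= k)%N -> eqmodX N (p + q * 'X^k) p.
Proof. by move=> Nk i iN; rewrite coefD coefMXn (leq_trans iN Nk) addr0. Qed.

Lemma eqmodX_prod1 (K : nzRingType) N n (F : nat -> {poly K}) :
  (forall i, (i < n)%N -> eqmodX N (F i) 1) ->
  eqmodX N (\prod_(i < n) F i) 1.
Proof.
elim: n => [|n IH] F1; first by rewrite big_ord0.
rewrite big_ord_recr /= -[X in eqmodX _ _ X]mulr1.
by apply: eqmodXM; [apply: IH => i /ltnW/F1 | apply: F1].
Qed.

(** * The pentagonal number theorem *)

Lemma sum_pm1 (V : nmodType) (F : int -> V) :
  \sum_(b <- [:: 1; -1] : seq int) F b = F 1 + F (-1).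
Proof. by rewrite !big_cons big_nil addr0. Qed.

(** The generalized pentagonal number k (3 k + b) / 2 for b = 1 or -1.
    Writing it as k ^ 2 plus a binomial coefficient avoids the division, and
    Pascal's rule then drives the induction. *)
Definition pent (b : int) (k : nat) : nat := (k * k + 'C(k + (b == 1)%R, 2))%N.

(** The partial sum of Euler's pentagonal series; its two families of
    exponents are indexed by b as in the sequences B. *)
Definition pent_poly (K : nzRingType) (n : nat) : {poly K} :=
  1 + \sum_(b <- [:: 1; -1] : seq int)
        \sum_(1 <= k < n.+1) (-1) ^+ k * 'X^(pent b k).

Definition euler_poly (K : nzRingType) (n : nat) : {poly K} :=
  \prod_(i < n) (1 - 'X^(i.+1)).

(** Shanks' finite form of the pentagonal number theorem. Passing from n to
    n + 1 multiplies each product by (1 - 'X^(n + 1)) and its monomial by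
    'X^s; the change of the s-th term is a difference of consecutive values
    of one sequence D, so the changes telescope. Their total gives the
    pentagonal monomial with b = -1, and the new term s = n + 1 gives the
    one with b = 1. *)
Lemma shanks (K : comNzRingType) (n : nat) :
  pent_poly K n = \sum_(0 <= s < n.+1)
    (-1) ^+ s * (\prod_(s <= i < n) (1 - 'X^(i.+1))) * 'X^(s * n + 'C(s.+1, 2)).
Proof.
elim: n => [|n IH].
  rewrite big_nat1 /pent_poly sum_pm1 !big_geq //.
  by rewrite !mulr1 !addr0.
pose T s := (-1) ^+ s * (\prod_(s <= i < n) (1 - 'X^(i.+1))) *
              'X^(s.+1 * n.+1 + 'C(s.+1, 2)) : {poly K}.
pose D s := if s is s'.+1 then - T s' else 0.
have step s : (s < n.+1)%N ->
    (-1) ^+ s * (\prod_(s <= i < n.+1) (1 - 'X^(i.+1))) *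
       'X^(s * n.+1 + 'C(s.+1, 2)) =
    (-1) ^+ s * (\prod_(s <= i < n) (1 - 'X^(i.+1))) *
       'X^(s * n + 'C(s.+1, 2)) + (D s.+1 - D s) :> {poly K}.
  rewrite ltnS => sn; rewrite big_nat_recr //= /D /T.
  case: s sn => [|s] sn /=.
    rewrite !mul0n !mul1n bin_small // !addn0; ring.
  rewrite [\prod_(s <= i < n) _]big_ltn //.
  (* All the exponents are offsets of c; that of T s is c itself. *)
  set c := (s.+1 * n + 'C(s.+2, 2))%N.
  have -> : (s.+1 * n.+1 + 'C(s.+2, 2) = c + s.+1)%N by rewrite /c; lia.
  have -> : (s.+2 * n.+1 + 'C(s.+2, 2) = c + s.+1 + n.+1)%N by rewrite /c; lia.
  have -> : (s.+1 * n.+1 + 'C(s.+1, 2) = c)%N.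
    by rewrite /c [in RHS]binS bin1; lia.
  rewrite !exprD [(-1) ^+ s.+1]exprS.
  move: ('X^(s.+1)) ('X^(n.+1)) => Y Z; ring.
transitivity (pent_poly K n + D n.+1 + (-1) ^+ n.+1 * 'X^(pent 1 n.+1)).
  rewrite /pent_poly !sum_pm1 ![\sum_(1 <= k < n.+2) _]big_nat_recr //=.
  rewrite /T [\prod_(n <= i < n) _]big_geq // /pent /= addn0 exprS; ring.
rewrite [RHS]big_nat_recr //= [\prod_(n.+1 <= i < n.+1) _]big_geq //.
rewrite mulr1 /pent /= addn1 IH; congr (_ + _).
under [RHS]eq_big_nat => s /andP[_ sn] do rewrite (step s sn).
by rewrite big_split /= telescope_sumr // subr0.
Qed.

(** In Shanks' identity the term s = 0 is the whole Euler product, while the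
    terms with s > 0 are divisible by 'X^(n + 1): their exponents are at
    least n + 1. *)
Lemma euler_pentagonal (K : comNzRingType) (N n : nat) :
  (N <= n.+1)%N -> eqmodX N (pent_poly K n) (euler_poly K n).
Proof.
move=> Nn; rewrite shanks big_ltn // mul1r mul0n bin_small // mulr1 big_mkord.
rewrite -/(euler_poly K n).
(* Factor 'X^(n + 1) out of the terms with s > 0. *)
rewrite [X in _ + X](_ : _ = (\sum_(1 <= s < n.+1)
    (-1) ^+ s * (\prod_(s <= i < n) (1 - 'X^(i.+1))) *
    'X^(s.-1 * n + 'C(s.+1, 2) - 1)) * 'X^(n.+1)).
  exact: eqmodX_addXn.
rewrite mulr_suml; apply: eq_big_nat => -[//|s] _.
rewrite -[RHS]mulrA -exprD; congr (_ * 'X^_).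
rewrite binS bin1; lia.
Qed.

(** * The generating function of partitions *)

(** The product over the parts i + 1 <= n of truncated geometric series; j
    is the multiplicity of the part. *)
Definition geom_prod (K : nzRingType) (n : nat) : {poly K} :=
  \prod_(i < n) \sum_(j < n.+1) 'X^(i.+1 * j).

(** Expanding the product of sums indexes the monomials by multiplicity
    functions, which are what npartitions counts. *)
Lemma npartitionsE (K : comNzRingType) (n : nat) :
  (npartitions n)%:R = (geom_prod K n)`_n.
Proof.
rewrite /geom_prod bigA_distr_bigA coef_sum /npartitions cardsE -sum1_card.
rewrite natr_sum big_mkcond /=; apply: eq_bigr => f _.
rewrite -expr_sum coefXn eq_sym unfold_in -eqnE; by case: eqn.
Qed.

(** Each factor telescopes: (1 + y + ... + y ^ n) (1 - y) = 1 - y ^ (n + 1)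
    with y = 'X^(i + 1), and y ^ (n + 1) vanishes modulo 'X^(n + 1). *)
Lemma geom_prod_euler (K : comNzRingType) (n : nat) :
  eqmodX n.+1 (geom_prod K n * euler_poly K n) 1.
Proof.
rewrite /geom_prod /euler_poly -big_split /=.
apply: (eqmodX_prod1 K n.+1 n
  (fun i => (\sum_(j < n.+1) 'X^(i.+1 * j)) * (1 - 'X^(i.+1)))) => i _ /=.
rewrite (_ : _ * _ = 1 + (-1) * 'X^(i.+1 * n.+1)).
  by apply: eqmodX_addXn; rewrite leq_pmull.
under eq_bigr => j _ do rewrite exprM.
have := subrX1 ('X^(i.+1) : {poly K}) n.+1.
rewrite -exprM mulN1r => E; rewrite -[X in 1 - X](subrK 1) E; ring.
Qed.

Lemma eqmodX_euler_poly (K : comNzRingType) (N n n' : nat) :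
  (N <= n.+1)%N -> (n <= n')%N -> eqmodX N (euler_poly K n) (euler_poly K n').
Proof.
move=> Nn nn'; rewrite -(subnK nn'); elim: (n' - n)%N => [//|k IH].
rewrite addSn /euler_poly big_ord_recr /= mulrBr mulr1 -mulNr.
apply: eqmodX_trans IH _; apply/eqmodX_sym/eqmodX_addXn; lia.
Qed.

(** Geometric products of different lengths are inverse to Euler products
    that agree to the given order, so they agree themselves by uniqueness of
    inverses. This is what lets one product of fixed length describe all the
    values npartitions i with i < N. *)
Lemma eqmodX_geom_prod (K : comNzRingType) (N n n' : nat) :
  (N <= n.+1)%N -> (n <= n')%N -> eqmodX N (geom_prod K n) (geom_prod K n').
Proof.
move=> Nn nn'.
have A := eqmodXW Nn (geom_prod_euler K n).
have B : eqmodX N (geom_prod K n' * euler_poly K n') 1.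
  by apply: (eqmodXW _ (geom_prod_euler K n')); lia.
have refl (p : {poly K}) : eqmodX N p p by [].
rewrite -[geom_prod K n]mulr1 -[geom_prod K n']mul1r.
(* With G, E of length n and G', E' of length n': insert 1 = G' E' after G,
   then replace E' by E in G (G' E') = G' (G E'), where G E = 1. *)
apply: eqmodX_trans (eqmodXM (refl _) (eqmodX_sym B)) _.
rewrite mulrCA mulrC; apply: eqmodXM => //.
apply: eqmodX_trans A; apply: eqmodXM => //.
exact/eqmodX_sym/eqmodX_euler_poly.
Qed.

(** Euler's recurrence for the partition numbers, as an identity of
    truncated series. *)
Lemma npartitions_inverse (K : comNzRingType) (N n : nat) : (N <= n.+1)%N ->
  eqmodX N ((\poly_(i < N) (npartitions i)%:R) * pent_poly K n) 1.
Proof.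
move=> Nn; apply: eqmodX_trans (eqmodXW Nn (geom_prod_euler K n)).
apply: eqmodXM; last exact: euler_pentagonal.
move=> i iN; rewrite coef_poly iN npartitionsE.
by apply: (eqmodX_geom_prod K i.+1) => //; lia.
Qed.

(** * The sequences B as Cauchy products *)

Lemma double_pent b k : b \in ([:: 1; -1] : seq int) ->
  k%:Z * (3 * k%:Z + b) = (pent b k)%:Z * 2.
Proof.
have E m : (2 * 'C(m, 2) = m.-1 * m)%N by rewrite mul_bin_left bin1 subn1.
rewrite !inE /pent => /orP[] /eqP -> /=.
  by have := E (k + 1)%N; rewrite addn1 /=; nia.
by have := E k; rewrite addn0; case: k => [|k] /=; nia.
Qed.

Lemma leq_pent b k : (k <= pent b k)%N.
Proof. by rewrite /pent; case: k => // k; nia. Qed.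

Lemma pent_argE m k b : b \in ([:: 1; -1] : seq int) ->
  pent_arg m k b = m.+1%:Z - (pent b k)%:Z.
Proof. by move=> hb; rewrite /pent_arg double_pent // mulzK. Qed.

(** The condition k <= (sqrt (24 m + 1) - b) / 6 reads (6 k + b) ^ 2 <= 24 m
    + 1, and (6 k + b) ^ 2 = 24 * pent b k + 1. *)
Lemma pent_boundE (R : realType) m k b : b \in ([:: 1; -1] : seq int) ->
  (0 < k)%N -> (k <= pent_bound R (24 * m + 1) b)%N = (pent b k <= m)%N.
Proof.
move=> hb k0; have bP : b = 1 \/ b = -1.
  by move: hb; rewrite !inE => /orP[] /eqP; [left | right].
set c := (24 * m + 1)%N.
have sqrt_ge1 : 1 <= Num.sqrt (c%:R : R).
  by rewrite -[leLHS]sqrtr1 ler_wsqrtr // ler1n /c addn1.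
rewrite /pent_bound truncn_ge_nat; last first.
  apply: divr_ge0 => //; rewrite subr_ge0.
  by case: bP => ->; [exact: sqrt_ge1 | apply: le_trans sqrt_ge1; lra].
rewrite ler_pdivlMr // lerBrDr.
have -> : k%:R * 6 + b%:~R = (absz (6 * k%:Z + b))%:R :> R.
  rewrite natr_absz ger0_norm; last by case: bP => ->; lia.
  by rewrite intrD intrM mulrC.
rewrite -[X in X <= _]ger0_norm ?ler0n // -sqrtr_sqr.
rewrite ler_psqrt ?nnegrE ?exprn_ge0 //.
rewrite -natrX ler_nat /c; have := double_pent b k hb.
by case: bP => ->; nia.
Qed.

(** Replaces a range of summation that depends on m and on a square root by
    a filter inside a fixed range, so that sums for different m or b can be
    compared term by term. *)
Lemma sum_pent_bound (R : realType) (V : nmodType) (F : nat -> V) m N b :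
  b \in ([:: 1; -1] : seq int) -> (m <= N)%N ->
  \sum_(1 <= k < (pent_bound R (24 * m + 1) b).+1) F k =
  \sum_(1 <= k < N.+1 | (pent b k <= m)%N) F k.
Proof.
move=> hb mN; set u := pent_bound _ _ _.
have uN : (u <= N)%N.
  have [->//|u0] := posnP u.
  apply: leq_trans mN; apply: leq_trans (leq_pent b u) _.
  by rewrite -(pent_boundE R).
rewrite (big_nat_widen _ _ N.+1) // big_nat_cond [RHS]big_nat_cond.
apply: eq_bigl => k; have [->|k0] := posnP k; first by [].
by rewrite [(k < u.+1)%N]ltnS pent_boundE.
Qed.

(** The sequence B is the Cauchy product of s (shifted by one) with the
    pentagonal series: the sign and the upper bounds in its definition are
    those of that series, cut where the exponent exceeds m. *)
Lemma B_of_coef (R : realType) (K : comNzRingType) (s : int -> K) m N :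
  (m < N)%N ->
  B_of R s m = (pent_poly K N * \poly_(i < N) s i.+1%:Z)`_m.
Proof.
move=> mN; rewrite /pent_poly mulrDl mul1r coefD coef_poly mN /B_of.
congr (_ + _); rewrite !sum_pm1 mulrDl coefD opprD.
have E b : b \in ([:: 1; -1] : seq int) ->
    - (\sum_(1 <= k < (pent_bound R (24 * m + 1) b).+1)
         (-1) ^+ k.+1 * s (pent_arg m k b)) =
    ((\sum_(1 <= k < N.+1) (-1) ^+ k * 'X^(pent b k)) *
       \poly_(i < N) s i.+1%:Z)`_m.
  move=> hb; rewrite (sum_pent_bound R K _ m N b hb (ltnW mN)).
  rewrite mulr_suml coef_sum big_mkcond -sumrN; apply: eq_bigr => k _.
  rewrite -mulrA (_ : (-1) ^+ k = ((-1) ^+ k)%:P); last first.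
    by rewrite rmorphXn rmorphN1.
  rewrite coefCM coefXnM coef_poly.
  case: leqP => [pm|_]; last by rewrite mulr0 oppr0.
  rewrite (leq_ltn_trans (leq_subr _ _) mN) exprS mulN1r mulNr opprK.
  by rewrite pent_argE // -subSn // subzn // ltnW.
by rewrite !E ?inE ?eqxx ?orbT.
Qed.

(** Convolving with the partition numbers cancels the pentagonal series in
    B, which leaves s. *)
Lemma sum_npartitions_B_of (R : realType) (K : comNzRingType) (s : int -> K)
    n d : (0 < d <= n)%N ->
  \sum_(0 <= m < n) (npartitionsz (d%:Z - m%:Z - 1))%:R * B_of R s m = s d%:Z.
Proof.
case: d => // d dn.
rewrite (big_cat_nat _ (n := d.+1)) //= [X in _ + X]big_nat_cond.
rewrite [X in _ + X]big1 ?addr0; last first.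
  move=> m /andP[/andP[dm _] _].
  (* For m >= d the partition number has a negative index. *)
  have -> : d.+1%:Z - m%:Z - 1 = Negz (m - d.+1) by lia.
  by rewrite mul0r.
rewrite big_mkord.
pose P := \poly_(i < d.+1) (npartitions i)%:R : {poly K}.
pose S := \poly_(i < d.+1) s i.+1%:Z : {poly K}.
transitivity ((P * (pent_poly K d.+1 * S))`_d).
  rewrite coefMr; apply: eq_bigr => m _; have md := ltn_ord m.
  rewrite coef_poly ltnS leq_subr -(B_of_coef R) //.
  by have -> : d.+1%:Z - (m : nat)%:Z - 1 = (d - m)%N%:Z by lia.
have H := npartitions_inverse K d.+1 d.+1 (leqnSn _).
rewrite mulrA (eqmodXM H (fun _ _ => erefl)) //.
by rewrite mul1r coef_poly leqnn.
Qed.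

Lemma pd_sum_B_of (R : realType) (K : comNzRingType) (s : int -> K) n :
  (0 < n)%N ->
  pd_sum (B_of R s) n =
  \sum_(d <- divisors n) (moebius (n %/ d))%:~R * s d%:Z.
Proof.
move=> n0; rewrite /pd_sum exchange_big /= big_seq [RHS]big_seq.
apply: eq_bigr => d; rewrite -dvdn_divisors // => dn.
rewrite -(sum_npartitions_B_of R K s n d); last first.
  by rewrite (dvdn_gt0 n0 dn) dvdn_leq.
by rewrite mulr_sumr; apply: eq_bigr => m _; rewrite mulrCA mulrA.
Qed.

(** B_mu sums over pentagonal numbers up to m + 1 instead of m; the
    additional terms have argument 0, hence vanish. *)
Lemma B_muE (R : realType) m :
  B_mu R m = B_of R (fun j => (j == 1)%:R) m.
Proof.
rewrite /B_mu /B_of -sumrN; congr ((_)%:R + _).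
apply: eq_big_seq => b hb.
have -> : (24 * m + 25 = 24 * m.+1 + 1)%N by lia.
rewrite (sum_pent_bound R _ _ m.+1 m.+1 b hb) //.
rewrite (sum_pent_bound R _ _ m m.+1 b hb) // -sumrN.
rewrite big_mkcond [RHS]big_mkcond; apply: eq_bigr => k _.
rewrite exprS mulN1r mulNr opprK pent_argE //.
have [pm|mp] := leqP (pent b k) m; first by rewrite leqW.
by rewrite lt_eqF ?mulr0 ?if_same //; lia.
Qed.

(** The closed form of B_phi evaluates alternating sums of quadratic
    polynomials in k. The parts with b = -1 and b = 1 depend on u1 and u2
    separately; E1 and E2 split the constant 8 as 5 + 3 so that each part
    vanishes for an empty sum. *)
Lemma B_phiE (R : realType) m :
  B_phi R m = B_of R (fun j => j%:~R) m.
Proof.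
have hp (k : nat) b : b \in ([:: 1; -1] : seq int) ->
    (pent_arg m k b)%:~R = m%:R + 1 - k%:R * (3 * k%:R + b%:~R) / 2 :> R.
  move=> hb; rewrite pent_argE // intrB natr1; congr (_ - _).
  have := congr1 (fun z : int => z%:~R : R) (double_pent b k hb).
  by rewrite /= !intrM !intrD !intrM -!pmulrn => ->; field.
rewrite /B_phi /B_of (sum_pm1 R).
set u1 := pent_bound _ _ (-1); set u2 := pent_bound _ _ 1.
have E1 : \sum_(1 <= k < u1.+1) (-1) ^+ k.+1 * (pent_arg m k (-1))%:~R =
   (5 - 5 * (-1) ^+ u1 + 4 * m%:R - 4 * (-1) ^+ u1 * m%:R
     + 2 * (-1) ^+ u1 * u1%:R * (3 * u1%:R + 2)) / 8 :> R.
  elim: u1 => [|u IH]; first by rewrite big_geq //=; field.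
  by rewrite big_nat_recr //= IH hp // !exprS -natr1 /=; field.
have E2 : \sum_(1 <= k < u2.+1) (-1) ^+ k.+1 * (pent_arg m k 1)%:~R =
   (3 + 4 * m%:R - 4 * (-1) ^+ u2 * m%:R
     + (-1) ^+ u2 * (6 * u2%:R ^+ 2 + 8 * u2%:R - 3)) / 8 :> R.
  elim: u2 => [|u IH]; first by rewrite big_geq //=; field.
  by rewrite big_nat_recr //= IH hp // !exprS -natr1 /=; field.
by rewrite E1 E2; field.
Qed.

(** * Divisor sums of the Moebius and Liouville functions *)

Lemma mem_divisors d n : (0 < n)%N -> (d \in divisors n) = (d %| n)%N.
Proof. by move=> n0; rewrite dvdn_divisors. Qed.

(** The induction removes one prime at a time, with its full power: the
    values of the functions considered on p ^ k * m are determined by those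
    on p ^ k and m. *)
Lemma prime_power_ind (P : nat -> Prop) :
  P 1%N ->
  (forall p k m, prime p -> coprime p m -> (0 < k)%N -> (0 < m)%N -> P m ->
     P (p ^ k * m)%N) ->
  forall n, (0 < n)%N -> P n.
Proof.
move=> P1 Pstep; elim/ltn_ind => n IH n0.
have [n1|n1] := leqP n 1; first by have -> : n = 1%N by lia.
have pr := pdiv_prime n1; set p := pdiv n in pr.
have [m cpm E] := pfactor_coprime pr n0.
have k0 : (0 < logn p n)%N by rewrite logn_gt0 mem_primes pr n0 pdiv_dvd.
have m0 : (0 < m)%N by case: m E {cpm} n0 => // ->.
rewrite E mulnC; apply: Pstep => //; apply: IH => //.
rewrite [ltnRHS]E -[ltnLHS]muln1 ltn_pmul2l //.
by rewrite -[1%N](expn0 p) ltn_exp2l ?prime_gt1.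
Qed.

(** By unique factorization, a divisor of p ^ k * m is p ^ j * d for exactly
    one j <= k and one divisor d of m. *)
Lemma perm_divisors_pM p k m : prime p -> coprime p m -> (0 < m)%N ->
  perm_eq (divisors (p ^ k * m))
          [seq (p ^ j * d)%N | j <- iota 0 k.+1, d <- divisors m].
Proof.
move=> pr cpm m0; have p0 := prime_gt0 pr.
have pn0 i : (0 < p ^ i)%N by rewrite expn_gt0 p0.
have cop i d : (d %| m)%N -> coprime (p ^ i) d.
  by move=> dm; apply: coprime_dvdr dm (coprimeXl _ cpm).
apply: uniq_perm; first exact: divisors_uniq.
  apply: allpairs_uniq; rewrite ?iota_uniq ?divisors_uniq //.
  move=> _ _ /allpairsP[[i d] [_ dm ->]] /allpairsP[[j e] [_ em ->]] /= E.
  move: dm em; rewrite !mem_divisors //= => dm em.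
  have L l f : (f %| m)%N -> logn p (p ^ l * f) = l.
    move=> fm; rewrite mulnC logn_Gauss ?pfactorK //.
    by rewrite -(expn1 p) cop.
  have ij : i = j by rewrite -(L i d dm) E L.
  by move/eqP: E; rewrite ij eqn_pmul2l // => /eqP ->.
move=> d; rewrite mem_divisors ?muln_gt0 ?pn0 //; apply/idP/allpairsP.
  move=> dd; have d0 : (0 < d)%N by apply: dvdn_gt0 dd; rewrite muln_gt0 pn0.
  have [e cpe E] := pfactor_coprime pr d0.
  exists (logn p d, e); split; [|rewrite mem_divisors // /=|by rewrite mulnC].
  rewrite mem_iota add0n ltnS /=.
  have := dvdn_leq_log p _ dd; rewrite muln_gt0 pn0 m0 => /(_ isT).
  by rewrite mulnC logn_Gauss ?pfactorK.
  rewrite -(@Gauss_dvdr e (p ^ k)) ?coprimeXr 1?coprime_sym //.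
  by apply: dvdn_trans dd; rewrite E dvdn_mulr.
case=> -[j e] []; rewrite mem_iota add0n ltnS mem_divisors //= => jk em ->.
by rewrite dvdn_mul // dvdn_exp2l.
Qed.

Lemma sum_divisors_pM (V : nmodType) (F : nat -> V) p k m :
  prime p -> coprime p m -> (0 < m)%N ->
  \sum_(d <- divisors (p ^ k * m)) F d =
  \sum_(0 <= j < k.+1) \sum_(d <- divisors m) F (p ^ j * d)%N.
Proof.
move=> pr cpm m0; rewrite (perm_big _ (perm_divisors_pM p k m pr cpm m0)).
by rewrite big_allpairs_dep /index_iota subn0.
Qed.

Lemma perm_primes_pM p k m : prime p -> coprime p m -> (0 < k)%N -> (0 < m)%N ->
  perm_eq (primes (p ^ k * m)) (p :: primes m).
Proof.
move=> pr cpm k0 m0; apply: uniq_perm; rewrite /= ?primes_uniq ?andbT //.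
  by rewrite mem_primes pr m0 /= -prime_coprime.
move=> q; have pk0 : (0 < p ^ k)%N by rewrite expn_gt0 prime_gt0.
rewrite [in LHS]primesM // primesX // primes_prime //.
by rewrite !inE.
Qed.

Lemma omega_pM p k m : prime p -> coprime p m -> (0 < k)%N -> (0 < m)%N ->
  omega (p ^ k * m) = (omega m).+1.
Proof.
move=> pr cpm k0 m0; rewrite /omega.
exact: (perm_size (perm_primes_pM p k m pr cpm k0 m0)).
Qed.

Lemma moebius_pM p k m : prime p -> coprime p m -> (0 < k)%N -> (0 < m)%N ->
  moebius (p ^ k * m) = if k == 1%N then - moebius m else 0.
Proof.
move=> pr cpm k0 m0; rewrite /moebius.
rewrite (perm_has _ (perm_primes_pM p k m pr cpm k0 m0)).
rewrite (perm_size (perm_primes_pM p k m pr cpm k0 m0)) /= exprS mulN1r.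
have -> : (p ^ 2 %| p ^ k * m)%N = (k != 1)%N.
  rewrite Gauss_dvdl ?coprimeXl // dvdn_Pexp2l; [lia | exact: prime_gt1].
case: eqP => //= k1; rewrite k1 expn1.
rewrite (_ : has _ _ = has (fun q => q ^ 2 %| m)%N (primes m)).
  by case: ifP; rewrite ?oppr0.
apply: eq_in_has => q; rewrite mem_primes => /and3P[qr _ qm].
rewrite Gauss_dvdr // coprimeXl // coprime_sym.
exact: (coprime_dvdr qm cpm).
Qed.

Lemma liouville_pM p k m : prime p -> coprime p m -> (0 < k)%N -> (0 < m)%N ->
  liouville (p ^ k * m) = (-1) ^+ k * liouville m.
Proof.
move=> pr cpm k0 m0; rewrite /liouville -exprD; congr (_ ^+ _).
rewrite (perm_big _ (perm_primes_pM p k m pr cpm k0 m0)) /= big_cons.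
rewrite mulnC logn_Gauss // pfactorK //; congr (_ + _)%N.
apply: eq_big_seq => q; rewrite mem_primes => /and3P[qr _ qm].
rewrite mulnC logn_Gauss // coprimeXr // coprime_sym.
exact: (coprime_dvdr qm cpm).
Qed.

(** For functions supported on squarefree numbers only the exponents 0 and 1
    of p contribute. *)
Lemma sum_divisors_pM_sqfree (V : nmodType) (F : nat -> V) p k m :
  prime p -> coprime p m -> (0 < k)%N -> (0 < m)%N ->
  (forall j d, (1 < j)%N -> (d %| m)%N -> F (p ^ j * d)%N = 0) ->
  \sum_(d <- divisors (p ^ k * m)) F d =
  \sum_(d <- divisors m) (F d + F (p ^ 1 * d)%N).
Proof.
move=> pr cpm k0 m0 F0; rewrite sum_divisors_pM // big_ltn // big_ltn //.
rewrite [X in _ + (_ + X)]big_nat [X in _ + (_ + X)]big1; last first.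
  move=> j /andP[j1 _]; rewrite big_seq big1 // => d.
  by rewrite mem_divisors //; apply: F0.
rewrite addr0 -big_split; apply: eq_bigr => d _.
by rewrite expn0 mul1n.
Qed.

Lemma sum_moebius n : (0 < n)%N ->
  \sum_(d <- divisors n) moebius d = (n == 1%N)%:R.
Proof.
move: n; apply: prime_power_ind => [|p k m pr cpm k0 m0 _].
  by rewrite big_seq1.
have E j d : (0 < j)%N -> (d %| m)%N ->
    moebius (p ^ j * d) = if j == 1%N then - moebius d else 0.
  by move=> j0 dm; rewrite moebius_pM ?(coprime_dvdr dm) ?(dvdn_gt0 m0 dm).
rewrite sum_divisors_pM_sqfree // => [|j d j1 dm]; last first.
  by rewrite E ?(ltnW j1) // gtn_eqF.
rewrite big_seq big1 => [|d].
  have := ltn_expl k (prime_gt1 pr); case: eqP => //; nia.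
by rewrite mem_divisors // => dm; rewrite E //= addrN.
Qed.

Lemma sum_abs_moebius n : (0 < n)%N ->
  \sum_(d <- divisors n) `|moebius d| = 2 ^+ omega n.
Proof.
move: n; apply: prime_power_ind => [|p k m pr cpm k0 m0 IH].
  by rewrite big_seq1.
have E j d : (0 < j)%N -> (d %| m)%N ->
    moebius (p ^ j * d) = if j == 1%N then - moebius d else 0.
  by move=> j0 dm; rewrite moebius_pM ?(coprime_dvdr dm) ?(dvdn_gt0 m0 dm).
rewrite sum_divisors_pM_sqfree // => [|j d j1 dm]; last first.
  by rewrite E ?(ltnW j1) // gtn_eqF.
rewrite omega_pM // exprS -IH mulr_sumr big_seq [RHS]big_seq.
apply: eq_bigr => d; rewrite mem_divisors // => dm.
by rewrite E //= normrN mulr_natl mulr2n.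
Qed.

Definition is_square n := [exists r : 'I_n.+1, n == r ^ 2]%N.

Lemma is_squareP n : reflect (exists r, n = r ^ 2)%N (is_square n).
Proof.
apply: (iffP existsP) => [[r /eqP ->]|[r E]]; first by exists r.
have rn : (r < n.+1)%N by rewrite E; case: r {E} => // r; nia.
by exists (Ordinal rn); apply/eqP.
Qed.

(** In r ^ 2 = p ^ k * m the exponent of p is 2 * logn p r, hence k is even
    and the rest of r squares to m. *)
Lemma is_square_pM p k m : prime p -> coprime p m -> (0 < m)%N ->
  is_square (p ^ k * m) = ~~ odd k && is_square m.
Proof.
move=> pr cpm m0; apply/is_squareP/andP => [[r E]|[ek /is_squareP[s ->]]].
  have r0 : (0 < r)%N.
    case: r E => // E; have : (0 < p ^ k * m)%N; last by rewrite E.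
    by rewrite muln_gt0 m0 expn_gt0 prime_gt0.
  have Ek : k = (2 * logn p r)%N.
    rewrite -lognX -E mulnC logn_Gauss // pfactorK //.
  rewrite Ek oddM /=; split=> //; apply/is_squareP.
  have [s _ Es] := pfactor_coprime pr r0; exists s.
  apply/eqP; rewrite -(@eqn_pmul2l (p ^ k)) ?expn_gt0 ?prime_gt0 //.
  by rewrite E {1}Es Ek expnMn mulnC (mulnC 2%N) expnM.
exists (p ^ k./2 * s)%N; rewrite expnMn -expnM.
by congr (p ^ _ * _)%N; move: (odd_double_half k); rewrite (negbTE ek); lia.
Qed.

(** The exponent j of p contributes the sign (-1) ^+ j, and these signs add
    up to 1 for even k and to 0 for odd k. *)
Lemma sum_liouville n : (0 < n)%N ->
  \sum_(d <- divisors n) liouville d = (is_square n)%:R.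
Proof.
move: n; apply: prime_power_ind => [|p k m pr cpm k0 m0 IH].
  rewrite big_seq1 /liouville big_nil.
  by rewrite (_ : is_square 1) //; apply/is_squareP; exists 1%N.
rewrite is_square_pM // -mulnb natrM -IH sum_divisors_pM //.
transitivity (\sum_(0 <= j < k.+1)
    ((-1) ^+ j * (\sum_(d <- divisors m) liouville d))).
  apply: eq_bigr => j _; rewrite mulr_sumr big_seq [RHS]big_seq.
  apply: eq_bigr => d; rewrite mem_divisors // => dm.
  case: j => [|j]; first by rewrite expn0 mul1n mul1r.
  by rewrite liouville_pM ?(coprime_dvdr dm) ?(dvdn_gt0 m0 dm).
rewrite -mulr_suml; congr (_ * _).
elim: k {k0} => [|k IHk]; first by rewrite big_nat1.
rewrite big_nat_recr //= IHk -signr_odd /=; by case: (odd k).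
Qed.

(** * The divisor sums of the von Mangoldt and totient functions *)

Lemma mangoldt_1 (R : realType) : mangoldt R 1 = 0.
Proof.
rewrite /mangoldt; case: pickP => // p /andP[pr /existsP[k /andP[k0 /eqP E]]].
have := ltn_expl k (prime_gt1 pr); nia.
Qed.

Lemma mangoldt_prime_power (R : realType) p k : prime p -> (0 < k)%N ->
  mangoldt R (p ^ k) = ln p%:R.
Proof.
move=> pr k0; rewrite /mangoldt; case: pickP => [q|H].
  case/andP=> qr /existsP[j /andP[j0 /eqP E]].
  have : (p %| q ^ j)%N by rewrite -E dvdn_exp.
  by rewrite Euclid_dvdX // j0 andbT dvdn_prime2 // => /eqP pq; rewrite -pq.
have pk : (p < (p ^ k).+1)%N by rewrite ltnS -{1}(expn1 p) leq_exp2l ?prime_gt1.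
have kk : (k < (p ^ k).+1)%N by rewrite ltnS ltnW // ltn_expl ?prime_gt1.
have /negP[] := negbT (H (Ordinal pk)); rewrite /= pr.
by apply/existsP; exists (Ordinal kk); rewrite /= k0 eqxx.
Qed.

Lemma mangoldt_pM (R : realType) p k m : prime p -> coprime p m ->
  (0 < k)%N -> (1 < m)%N -> mangoldt R (p ^ k * m) = 0.
Proof.
move=> pr cpm k0 m1; rewrite /mangoldt; case: pickP => // q.
case/andP=> qr /existsP[j /andP[j0 /eqP E]].
have pq : p = q.
  have : (p %| q ^ j)%N by rewrite -E dvdn_mulr // dvdn_exp.
  by rewrite Euclid_dvdX // j0 andbT dvdn_prime2 // => /eqP.
have : coprime (q ^ j) m by rewrite -pq coprimeXl.
by rewrite -E coprimeMl => /andP[_]; rewrite /coprime gcdnn; lia.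
Qed.

(** Among the divisors p ^ j * d with j > 0 only those with d = 1
    contribute, each ln p, and there are k of them. *)
Lemma sum_mangoldt (R : realType) n : (0 < n)%N ->
  \sum_(d <- divisors n) mangoldt R d = ln n%:R.
Proof.
move: n; apply: prime_power_ind => [|p k m pr cpm k0 m0 IH].
  by rewrite big_seq1 mangoldt_1 ln1.
have p0 : 0 < p%:R :> R by rewrite ltr0n prime_gt0.
rewrite natrM natrX lnM ?posrE ?ltr0n //; last exact: exprn_gt0.
rewrite lnXn // -IH.
rewrite sum_divisors_pM // big_ltn // addrC; congr (_ + _); last first.
  by apply: eq_bigr => d _; rewrite expn0 mul1n.
transitivity (\sum_(1 <= j < k.+1) ln (p%:R : R)); last first.
  by rewrite sumr_const_nat subn1.
apply: eq_big_nat => j /andP[j0 _].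
rewrite (bigD1_seq 1%N) ?divisors_uniq ?divisor1 //= muln1.
rewrite mangoldt_prime_power // big_seq_cond big1 ?addr0 // => d.
rewrite mem_divisors // => /andP[dm d1].
rewrite mangoldt_pM ?(coprime_dvdr dm) //.
by have := dvdn_gt0 m0 dm; move: d1; lia.
Qed.

Lemma sum_totient n : (0 < n)%N -> (\sum_(d <- divisors n) totient d = n)%N.
Proof.
move=> n0; rewrite -[RHS]sum_totient_dvd.
rewrite -(big_mkord (fun d => d %| n)%N totient) -[RHS]big_filter.
apply: perm_big.
apply: uniq_perm; rewrite ?divisors_uniq ?filter_uniq ?iota_uniq //.
move=> d; rewrite mem_filter mem_index_iota mem_divisors //= ltnS.
by case: (boolP (d %| n)%N) => //= /(dvdn_leq n0) ->.
Qed.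

(** * Moebius inversion *)

(** Exchanging the sums, the coefficient of a e is the sum of moebius (n %/
    d) over the d with e %| d %| n; as n %/ d then runs through the divisors
    of n %/ e, it is 1 for e = n and 0 otherwise. *)
Lemma moebius_inversion (K : pzRingType) (a s : nat -> K) n :
  (forall d, (0 < d)%N -> \sum_(e <- divisors d) a e = s d) -> (0 < n)%N ->
  \sum_(d <- divisors n) (moebius (n %/ d))%:~R * s d = a n.
Proof.
move=> has n0.
transitivity (\sum_(d <- divisors n) \sum_(e <- divisors n | (e %| d)%N)
                (moebius (n %/ d))%:~R * a e).
  rewrite big_seq [RHS]big_seq; apply: eq_bigr => d; rewrite mem_divisors //.
  move=> dn; have d0 := dvdn_gt0 n0 dn; rewrite -has // mulr_sumr.
  rewrite -[RHS]big_filter.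
  apply: perm_big; apply: uniq_perm; rewrite ?filter_uniq ?divisors_uniq //.
  move=> e; rewrite mem_filter !mem_divisors //.
  by case: (boolP (e %| d)%N) => // /dvdn_trans ->.
rewrite (exchange_big_dep xpredT) //=.
transitivity (\sum_(e <- divisors n) (e == n)%:R * a e); last first.
  rewrite (bigD1_seq n) ?divisors_uniq ?divisors_id //=.
  rewrite eqxx mul1r big1 ?addr0 //.
  by move=> e /negbTE ->; rewrite mul0r.
rewrite big_seq [RHS]big_seq; apply: eq_bigr => e.
rewrite mem_divisors // => en.
have e0 := dvdn_gt0 n0 en; rewrite -mulr_suml; congr (_ * _).
have q0 : (0 < n %/ e)%N by rewrite divn_gt0 // dvdn_leq.
transitivity ((\sum_(c <- divisors (n %/ e)) moebius c)%:~R : K); last first.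
  by rewrite sum_moebius // [(n %/ e)%N == _]eq_sym eqn_div // mul1n; case: eqP.
rewrite -big_filter rmorph_sum /=.
rewrite -(big_map (fun d => n %/ d)%N xpredT (fun c => (moebius c)%:~R)).
apply: perm_big; apply: uniq_perm; rewrite ?divisors_uniq //.
  rewrite map_inj_in_uniq ?filter_uniq ?divisors_uniq // => c d.
  rewrite !mem_filter !mem_divisors // => /andP[_ cn] /andP[_ dn] E.
  apply/eqP; rewrite -(@eqn_pmul2l (n %/ c)) ?divn_gt0 ?(dvdn_gt0 n0 cn) //.
    by rewrite {2}E !divnK.
  exact: dvdn_leq.
move=> c; rewrite mem_divisors //; apply/mapP/idP => [[d]|].
  rewrite mem_filter mem_divisors // => /andP[ed dn] ->.
  have d0 := dvdn_gt0 n0 dn; case/dvdnP: dn => y ->; rewrite mulnK //.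
  by case/dvdnP: ed => x ->; rewrite mulnA mulnK // dvdn_mulr.
case/dvdnP => z Ez; have En : (n = z * c * e)%N by rewrite -Ez divnK.
have [z0 c0] : (0 < z)%N /\ (0 < c)%N.
  by apply/andP; rewrite -muln_gt0 -Ez.
exists (z * e)%N; last by rewrite En mulnAC mulKn // muln_gt0 z0.
by rewrite mem_filter mem_divisors // dvdn_mull //= En mulnAC dvdn_mulr.
Qed.

(** * The six expansions *)

Lemma sqrt_intE (R : realType) n :
  (Num.sqrt (n%:R : R) \is a Num.int) = is_square n.
Proof.
apply/idP/is_squareP => [|[r ->]]; last first.
  by rewrite natrX sqrtr_sqr ger0_norm // rpred_nat.
rewrite intrEge0 ?sqrtr_ge0 // => /natrP[r E]; exists r.
by apply/eqP; rewrite -(eqr_nat R) natrX -E sqr_sqrtr.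
Qed.

(** The common principle behind the six formulas: each follows from the
    divisor sum of its function. *)
Lemma pd_sum_inverse (R : realType) (K : comNzRingType) (B a : nat -> K)
    (s : int -> K) n :
  (forall m, B m = B_of R s m) ->
  (forall d, (0 < d)%N -> \sum_(e <- divisors d) a e = s d%:Z) ->
  (0 < n)%N -> a n = pd_sum B n.
Proof.
move=> hB has n0.
rewrite -(moebius_inversion K a (fun d => s d%:Z) n has n0).
rewrite -(pd_sum_B_of R) //; apply: eq_bigr => m _; apply: eq_bigr => d _.
by rewrite hB.
Qed.

Lemma eq_summatory (R : realType) (K : pzRingType) (a b : nat -> K) (x : R) :
  (forall n, (0 < n)%N -> a n = b n) -> summatory a x = summatory b x.
Proof. by move=> ab; apply: eq_big_nat => n /andP[n0 _]; apply: ab. Qed.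

Theorem corollary3p3 (R : realType) (t : R[i]) (J : nat -> R[i])
    (hJ : is_jordan_totient t J) :
  (forall n : nat, (1 <= n)%N ->
     (totient n)%:R = pd_sum (B_phi R) n /\
     (moebius n)%:~R = pd_sum (B_mu R) n /\
     (liouville n)%:~R = pd_sum (B_lambda R) n /\
     mangoldt R n = pd_sum (B_Lambda R) n /\
     `|(moebius n)%:~R| = pd_sum (B_absmu R) n /\
     J n = pd_sum (B_J t) n) /\
  (forall x : R, 1 <= x ->
     summatory (fun n => (totient n)%:R) x = summatory (pd_sum (B_phi R)) x /\
     summatory (fun n => (moebius n)%:~R) x = summatory (pd_sum (B_mu R)) x /\
     summatory (fun n => (liouville n)%:~R) x
       = summatory (pd_sum (B_lambda R)) x /\
     summatory (mangoldt R) x = summatory (pd_sum (B_Lambda R)) x /\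
     summatory (fun n => `|(moebius n)%:~R|) x
       = summatory (pd_sum (B_absmu R)) x /\
     summatory J x = summatory (pd_sum (B_J t)) x).
Proof.
have Hphi n : (0 < n)%N -> (totient n)%:R = pd_sum (B_phi R) n.
  apply: (pd_sum_inverse R R _ (fun n => (totient n)%:R) _ n (B_phiE R)).
  by move=> d d0; rewrite -natr_sum sum_totient.
have Hmu n : (0 < n)%N -> (moebius n)%:~R = pd_sum (B_mu R) n.
  apply: (pd_sum_inverse R R _ (fun n => (moebius n)%:~R) _ n (B_muE R)).
  by move=> d d0; rewrite -rmorph_sum /= sum_moebius //; case: d d0 => [|[|d]].
have Hlambda n : (0 < n)%N -> (liouville n)%:~R = pd_sum (B_lambda R) n.
  apply: (pd_sum_inverse R R _ (fun n => (liouville n)%:~R) _ n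
            (fun m => erefl)).
  move=> d d0; rewrite -rmorph_sum /= sum_liouville // -pmulrn.
  by rewrite sqrt_intE; case: is_square.
have HLambda n : (0 < n)%N -> mangoldt R n = pd_sum (B_Lambda R) n.
  apply: (pd_sum_inverse R R _ (mangoldt R) _ n (fun m => erefl)).
  by move=> d d0; rewrite sum_mangoldt.
have Habsmu n : (0 < n)%N -> `|(moebius n)%:~R| = pd_sum (B_absmu R) n.
  apply: (pd_sum_inverse R R _ (fun n => `|(moebius n)%:~R|) _ n
            (fun m => erefl)).
  move=> d d0; under eq_bigr => e _ do rewrite -intr_norm.
  by rewrite -rmorph_sum /= sum_abs_moebius // rmorphXn.
have HJ n : (0 < n)%N -> J n = pd_sum (B_J t) n.
  by apply: (pd_sum_inverse R R[i] _ J _ n (fun m => erefl)).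
by split=> [n n0|x _]; do !split; auto; exact: eq_summatory.
Qed.
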